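(* Let $\mathcal{X}\in\mathbb{R}^{I_1\times\cdots\times I_N}$ be a tensor, let $\mathcal{G}_k\in\mathbb{R}^{R_k\times I_k\times R_{k+1}}$ ($k=1,\dots,N$, $R_{N+1}=R_1$) be nonzero TR-cores, fix $n\in\{1,\dots,N\}$, and put $J_n=\prod_{j\neq n}I_j$. Let $\mathbf{G}^{\neq n}_{[2]}\in\mathbb{R}^{J_n\times R_nR_{n+1}}$ be the mode-2 unfolding of the subchain tensor $\mathcal{G}^{\neq n}$, and let $\mathbf{X}_{[n]}\in\mathbb{R}^{I_n\times J_n}$ be the mode-$n$ unfolding of $\mathcal{X}$. Let $\mathbf{\Psi}_n=\mathbf{D}_n\mathbf{S}_n\in\mathbb{R}^{m\times J_n}$ be the leverage-based sampling matrix with $m$ samples, built from the product distribution $\mathbf{q}^{\neq n}$ of the normalized leverage scores of the cores $\mathcal{G}_k$, $k\ne n$, and let $$\tilde{\mathbf{G}}_{n(2)}=\arg\min_{\mathbf{G}_{n(2)}\in\mathbb{R}^{I_n\times R_nR_{n+1}}}\left\|\mathbf{X}_{[n]}\mathbf{\Psi}_n^{\top}-\mathbf{G}_{n(2)}\left(\mathbf{\Psi}_n\mathbf{G}^{\neq n}_{[2]}\right)^{\top}\right\|_F .$$ Let $\varepsilon\in(0,1)$ and $\delta\in(0,1)$. If $$m\ >\ \left(\prod_{j=1}^NR_j^2\right)\max\left[\frac{16}{3(\sqrt2-1)^2}\ln\left(\frac{4R_nR_{n+1}}{\delta}\right),\ \frac{4}{\varepsilon\delta}\right],$$ then, with probability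 at least $1-\delta$, $$\left\|\mathbf{X}_{[n]}-\tilde{\mathbf{G}}_{n(2)}\left(\mathbf{G}^{\neq n}_{[2]}\right)^{\top}\right\|_F\le(1+\varepsilon)\min_{\mathbf{G}_{n(2)}\in\mathbb{R}^{I_n\times R_nR_{n+1}}}\left\|\mathbf{X}_{[n]}-\mathbf{G}_{n(2)}\left(\mathbf{G}^{\neq n}_{[2]}\right)^{\top}\right\|_F .$$
   Context: Index convention: for $i_k\in\{1,\dots,I_k\}$, $\overline{i_1i_2\cdots i_N}=1+\sum_{k=1}^N(i_k-1)\prod_{j=1}^{k-1}I_j$ (first index varies fastest), and similarly for any other ordered list of indices. Unfoldings: the mode-$n$ unfolding of $\mathcal{X}\in\mathbb{R}^{I_1\times\cdots\times I_N}$ is the $I_n\times\prod_{j\ne n}I_j$ matrix with $\mathbf{X}_{[n]}(i_n,\overline{i_{n+1}\cdots i_Ni_1\cdots i_{n-1}})=\mathcal{X}(i_1,\dots,i_N)$. The classical mode-$n$ unfolding is $\mathbf{X}_{(n)}(i_n,\overline{i_1\cdots i_{n-1}i_{n+1}\cdots i_N})=\mathcal{X}(i_1,\dots,i_N)$; $\mathbf{G}_{k(2)}\in\mathbb{R}^{I_k\times R_kR_{k+1}}$ denotes the classical mode-2 unfolding of a core $\mathcal{G}_k\in\mathbb{R}^{R_k\times I_k\times R_{k+1}}$ (so minimizing over $\mathcal{G}_n$ is the same as minimizing over all real $I_n\times R_nR_{n+1}$ matrices). TR-cores and subchain tensor: write $\mathbf{G}_k(i_k)=\mathcal{G}_k(:,i_k,:)\in\mathbb{R}^{R_k\times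 R_{k+1}}$ for the lateral slices, with $R_{N+1}=R_1$. The subchain tensor $\mathcal{G}^{\neq n}\in\mathbb{R}^{R_{n+1}\times J_n\times R_n}$ is defined by its lateral slices $$\mathbf{G}^{\neq n}(\overline{i_{n+1}\cdots i_Ni_1\cdots i_{n-1}})=\mathbf{G}_{n+1}(i_{n+1})\cdots\mathbf{G}_N(i_N)\,\mathbf{G}_1(i_1)\cdots\mathbf{G}_{n-1}(i_{n-1}),$$ and $\mathbf{G}^{\neq n}_{[2]}$ is its mode-2 unfolding, of size $J_n\times R_nR_{n+1}$. Leverage scores: for a matrix $\mathbf{A}$, let $\mathbf{Q}$ be a matrix whose columns form an orthonormal basis of the column space of $\mathbf{A}$; the leverage score of the $i$-th row is $\ell_i(\mathbf{A})=\|\mathbf{Q}(i,:)\|_2^2$ (independent of the choice of $\mathbf{Q}$). Sampling distribution: for each $k$, $\mathbf{p}_k(i_k)=\ell_{i_k}(\mathbf{G}_{k(2)})/\mathrm{rank}(\mathbf{G}_{k(2)})$ is a probability distribution on $\{1,\dots,I_k\}$, and $$\mathbf{q}^{\neq n}(\overline{i_{n+1}\cdots i_Ni_1\cdots i_{n-1}})=\prod_{k\ne n}\mathbf{p}_k(i_k)$$ is a probability distribution on $\{1,\dots,J_n\}$. Leverage-based sampling matrix: $\mathbf{\Psi}_n=\mathbf{D}_n\mathbf{S}_n$, where $\mathbf{S}_n\in\mathbb{R}^{m\times J_n}$ has $(\mathbf{S}_n)_{ij}=1$ if index $j$ is chosen in the $i$-th of $m$ independent random trials, each trial choosing index $j$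 with probability $\mathbf{q}^{\neq n}(j)$, and $(\mathbf{S}_n)_{ij}=0$ otherwise; $\mathbf{D}_n\in\mathbb{R}^{m\times m}$ is diagonal with $(\mathbf{D}_n)_{ii}=1/\sqrt{m\,\mathbf{q}^{\neq n}(j)}$, where $j$ is the index chosen in trial $i$. In the streaming setting, mode $N$ is time and $I_N$ is the temporal dimension of the tensor being sketched. Probability is over the random sampling. *)

(* Defs.v *)
From HB Require Import structures.
From mathcomp Require Import all_boot all_order all_algebra.
From mathcomp Require Import all_classical all_reals all_analysis.
Set Implicit Arguments.
Unset Strict Implicit.
Unset Printing Implicit Defensive.
Import Order.TTheory GRing.Theory Num.Theory.
Local Open Scope classical_set_scope.
Local Open Scope ring_scope.

(* Modes, indices and ranks are 0-based; [ordS] is the cyclic successor of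
   'I_N, so that [rk (ordS k)] is R_(k+1) with R_(N+1) = R_1. *)

Definition multi_index (N : nat) (dim : 'I_N -> nat) :=
  {dffun forall k : 'I_N, 'I_(dim k)}.

Definition tensor (R : Type) (N : nat) (dim : 'I_N -> nat) :=
  multi_index dim -> R.

Definition tr_cores (R : Type) (N : nat) (dim rk : 'I_N -> nat) :=
  forall k : 'I_N, 'I_(rk k) -> 'I_(dim k) -> 'I_(rk (ordS k)) -> R.

Definition linear_index (N : nat) (dim : 'I_N -> nat) (s : seq 'I_N)
    (a : multi_index dim) : nat :=
  (\sum_(t < size s) a (tnth (in_tuple s) t) *
     \prod_(u < size s | u < t) dim (tnth (in_tuple s) u))%N.

(* The modes n+1, ..., N, 1, ..., n-1, in this order. *)
Definition other_modes (N : nat) (n : 'I_N) : seq 'I_N :=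
  drop n.+1 (enum 'I_N) ++ take n (enum 'I_N).

Definition num_cols (N : nat) (dim : 'I_N -> nat) (n : 'I_N) : nat :=
  (\prod_(j < N | j != n) dim j)%N.

Lemma linear_index_cons (N : nat) (dim : 'I_N -> nat) (k : 'I_N)
    (s : seq 'I_N) (a : multi_index dim) :
  linear_index (k :: s) a = (a k + dim k * linear_index s a)%N.
Proof.
have nthS (t : 'I_(size s)) :
    tnth (in_tuple (k :: s)) (lift ord0 t) = tnth (in_tuple s) t.
  by rewrite !(tnth_nth k).
rewrite /linear_index big_ord_recl /= big_pred0 // muln1 (tnth_nth k) /=.
congr addn; rewrite big_distrr; apply: eq_bigr => t _ /=.
rewrite nthS mulnCA; congr muln.
rewrite big_mkcond big_ord_recl /= (tnth_nth k) /=; congr muln.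
by rewrite [RHS]big_mkcond; apply: eq_bigr => u _; rewrite nthS.
Qed.

Lemma linear_index_lt (N : nat) (dim : 'I_N -> nat) (s : seq 'I_N)
    (a : multi_index dim) :
  (linear_index s a < \prod_(k <- s) dim k)%N.
Proof.
elim: s => [|k s IHs]; first by rewrite /linear_index big_ord0 big_nil.
rewrite linear_index_cons big_cons.
apply: (@leq_trans (dim k * (linear_index s a).+1)); last by rewrite leq_mul2l IHs orbT.
by rewrite mulnS ltn_add2r.
Qed.

Lemma linear_index_inj (N : nat) (dim : 'I_N -> nat) (s : seq 'I_N)
    (a b : multi_index dim) :
  linear_index s a = linear_index s b -> forall k, k \in s -> a k = b k.
Proof.
elim: s => [|l s IHs] // E k.
have dl0 : (0 < dim l)%N := leq_ltn_trans (leq0n _) (ltn_ord (a l)).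
move: E; rewrite !linear_index_cons => E.
have Eal : a l = b l.
  apply: val_inj => /=; move/(congr1 (modn^~ (dim l))): E.
  by rewrite !(mulnC (dim l)) !(addnC _ (_ * _)%N) !modnMDl !modn_small.
rewrite inE => /orP[/eqP->//|]; apply: IHs.
by move: E; rewrite Eal => /addnI/eqP; rewrite eqn_pmul2l // => /eqP.
Qed.

Lemma perm_other_modes (N : nat) (n : 'I_N) :
  perm_eq (n :: other_modes n) (enum 'I_N).
Proof.
rewrite -[X in perm_eq _ X](cat_take_drop n) perm_sym perm_catC.
by rewrite (drop_nth n) ?size_enum_ord // nth_ord_enum.
Qed.

Lemma other_modes_uniq (N : nat) (n : 'I_N) : uniq (n :: other_modes n).
Proof. by rewrite (perm_uniq (perm_other_modes n)) enum_uniq. Qed.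

Lemma mem_other_modes (N : nat) (n k : 'I_N) :
  (k \in other_modes n) = (k != n).
Proof.
have := perm_mem (perm_other_modes n) k; rewrite mem_enum inE.
have /andP[nin _] := other_modes_uniq n.
by case: eqP => [->|//] _; rewrite (negbTE nin).
Qed.

Lemma prod_other_modes (N : nat) (dim : 'I_N -> nat) (n : 'I_N) :
  (\prod_(k <- other_modes n) dim k)%N = num_cols dim n.
Proof.
have p : perm_eq (other_modes n) [seq k <- enum 'I_N | k != n].
  apply: uniq_perm; first by have /andP[] := other_modes_uniq n.
    by rewrite filter_uniq ?enum_uniq.
  by move=> k; rewrite mem_other_modes mem_filter mem_enum andbT.
by rewrite (perm_big _ p) /= big_filter big_enum_cond.
Qed.

Lemma col_index_lt (N : nat) (dim : 'I_N -> nat) (n : 'I_N)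
    (a : multi_index dim) :
  (linear_index (other_modes n) a < num_cols dim n)%N.
Proof. by rewrite -prod_other_modes linear_index_lt. Qed.

Definition col_index (N : nat) (dim : 'I_N -> nat) (n : 'I_N)
    (a : multi_index dim) : 'I_(num_cols dim n) :=
  Ordinal (col_index_lt n a).

Lemma col_index_inj (N : nat) (dim : 'I_N -> nat) (n : 'I_N)
    (a b : multi_index dim) :
  col_index n a = col_index n b -> forall k, k != n -> a k = b k.
Proof.
move=> /(congr1 val)/= E k; rewrite -mem_other_modes; exact: linear_index_inj.
Qed.

Lemma col_index_surj (N : nat) (dim : 'I_N -> nat) (n : 'I_N)
    (i : 'I_(dim n)) (j : 'I_(num_cols dim n)) :
  exists2 a : multi_index dim, a n = i & col_index n a = j.
Proof.
pose f (a : multi_index dim) := (a n, col_index n a).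
have f_inj : injective f.
  move=> a b E; have En : a n = b n := congr1 fst E.
  have Ec : col_index n a = col_index n b := congr1 snd E.
  by apply/ffunP => k; case: (eqVneq k n) => [->//|]; apply: col_index_inj.
have : (i, j) \in codom f.
  apply: inj_card_onto => //.
  rewrite card_prod !card_ord card_dep_ffun foldrE big_map big_enum /=.
  rewrite /num_cols [leqRHS](bigD1 n) //= card_ord leq_mul2l.
  apply/orP; right; apply: eq_leq.
  by apply: eq_bigr => k _; rewrite card_ord.
by case/codomP => a [-> ->]; exists a.
Qed.

(* The entry at (i, j) is [X a] for the unique multi-index [a] with i_n = i
   whose remaining indices encode to j; the default value is never used. *)
Definition unfolding (R : realType) (N : nat) (dim : 'I_N -> nat)
    (X : tensor R dim) (n : 'I_N) : 'M[R]_(dim n, num_cols dim n) :=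
  \matrix_(i, j)
    if [pick a : multi_index dim | (a n == i) && (col_index n a == j)]
    is Some a then X a else 0.

Lemma unfoldingE (R : realType) (N : nat) (dim : 'I_N -> nat)
    (X : tensor R dim) (n : 'I_N) (a : multi_index dim) :
  unfolding X n (a n) (col_index n a) = X a.
Proof.
rewrite mxE; case: pickP => [b /andP[/eqP En /eqP Ec]|/(_ a)]; last by rewrite !eqxx.
congr X; apply/ffunP => k.
by case: (eqVneq k n) => [->//|]; apply: col_index_inj.
Qed.

Definition lateral_slice (R : Type) (p d q : nat)
    (C : 'I_p -> 'I_d -> 'I_q -> R) (i : 'I_d) : 'M[R]_(p, q) :=
  \matrix_(u, v) C u i v.

Lemma index_allpairs_pair (S T : eqType) (s : seq S) (t : seq T) (x : S)
    (y : T) :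
  x \in s -> y \in t ->
  index (x, y) [seq (x', y') | x' <- s, y' <- t]
  = (index x s * size t + index y t)%N.
Proof.
move=> + yt; elim: s => [//|z s IHs]; rewrite inE allpairs_cons index_cat /=.
case: (eqVneq z x) => [-> _|zx].
  rewrite map_f // mul0n add0n index_map // => y1 y2 [] //.
move=> /= xs; rewrite ifN; last first.
  by apply/mapP => -[y' _ [/esym/eqP]]; rewrite (negbTE zx).
by rewrite IHs // size_map mulSn addnA.
Qed.

Lemma val_mxvec_index (p q : nat) (u : 'I_p) (v : 'I_q) :
  val (mxvec_index u v) = (u * q + v)%N.
Proof.
have -> : val (mxvec_index u v) = index (u, v) (enum {: 'I_p * 'I_q}).
  rewrite -[X in index X _](nth_enum_rank (u, v)) index_uniq ?enum_uniq //.
  by rewrite -cardE.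
rewrite enumT unlock /= /prod_enum index_allpairs_pair ?mem_enum //.
by rewrite !index_enum_ord size_enum_ord.
Qed.

(* [mxvec] is row-major, so that transposing the slice makes the first index
   of the core vary fastest. *)
Definition unfold2 (R : Type) (p d q : nat)
    (C : 'I_p -> 'I_d -> 'I_q -> R) : 'M[R]_(d, q * p) :=
  \matrix_(i < d) mxvec (lateral_slice C i)^T.

(* G_k(a_k) G_(k+1)(a_(k+1)) ... (t factors, cyclically). *)
Fixpoint slice_chain (R : realType) (N : nat) (dim rk : 'I_N -> nat)
    (G : tr_cores R dim rk) (a : multi_index dim) (k : 'I_N) (t : nat) :
    'M[R]_(rk k, rk (iter t (@ordS N) k)) :=
  if t is t'.+1 then
    slice_chain G a k t' *m
      lateral_slice (G (iter t' (@ordS N) k)) (a (iter t' (@ordS N) k))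
  else 1%:M.

Lemma iter_ordS_val (N : nat) (k : 'I_N) (t : nat) :
  val (iter t (@ordS N) k) = ((k + t) %% N)%N.
Proof.
elim: t => [|t IHt] /=; first by rewrite addn0 modn_small.
by rewrite [val _]IHt -addn1 modnDml addn1 addnS.
Qed.

Lemma iter_ordS_full (N : nat) (n : 'I_N) :
  iter N.-1 (@ordS N) (ordS n) = n.
Proof.
have N0 : (0 < N)%N := leq_ltn_trans (leq0n _) (ltn_ord n).
apply: val_inj; rewrite -iterSr prednK // iter_ordS_val modnDr modn_small //.
Qed.

Definition subchain_product (R : realType) (N : nat) (dim rk : 'I_N -> nat)
    (G : tr_cores R dim rk) (n : 'I_N) (a : multi_index dim) :
    'M[R]_(rk (ordS n), rk n) :=
  castmx (erefl, congr1 rk (iter_ordS_full n))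
    (slice_chain G a (ordS n) N.-1).

(* The product does not involve the n-th component of [a], so that any [a]
   encoding to j will do. *)
Definition subchain (R : realType) (N : nat) (dim rk : 'I_N -> nat)
    (G : tr_cores R dim rk) (n : 'I_N)
    (u : 'I_(rk (ordS n))) (j : 'I_(num_cols dim n)) (v : 'I_(rk n)) : R :=
  if [pick a : multi_index dim | col_index n a == j] is Some a
  then subchain_product G n a u v else 0.

Arguments subchain {R N dim rk} G n u j v.

Lemma eq_slice_chain (R : realType) (N : nat) (dim rk : 'I_N -> nat)
    (G : tr_cores R dim rk) (a b : multi_index dim) (k : 'I_N) (t : nat) :
  (forall i, (i < t)%N ->
     a (iter i (@ordS N) k) = b (iter i (@ordS N) k)) ->
  slice_chain G a k t = slice_chain G b k t.
Proof.
elim: t => [//|t IHt] E /=; rewrite (E t) // IHt // => i it.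
by apply: E; rewrite ltnW.
Qed.

Lemma subchainE (R : realType) (N : nat) (dim rk : 'I_N -> nat)
    (G : tr_cores R dim rk) (n : 'I_N) (a : multi_index dim) :
  lateral_slice (subchain G n) (col_index n a) =
  subchain_product G n a.
Proof.
apply/matrixP => u v; rewrite mxE /subchain.
case: pickP => [b /eqP Eb|/(_ a)]; last by rewrite eqxx.
congr (castmx _ _ _ _); apply: eq_slice_chain => i iN.
apply: (col_index_inj Eb); rewrite -iterSr.
apply/eqP => En; have := iter_ordS_val n i.+1; rewrite En => /esym E.
have N0 : (0 < N)%N := leq_ltn_trans (leq0n _) (ltn_ord n).
have : (n + i.+1 == n + 0 %[mod N])%N by rewrite E addn0 modn_small.
by rewrite eqn_modDl mod0n modn_small // -(prednK N0) ltnS.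
Qed.

(* The (cyclic) mode-2 unfolding orders the column modes as 3, 1. *)
Definition cyclic_unfold2 (R : Type) (p d q : nat)
    (C : 'I_p -> 'I_d -> 'I_q -> R) : 'M[R]_(d, p * q) :=
  \matrix_(i < d) mxvec (lateral_slice C i).

Definition subchain_unfolding (R : realType) (N : nat)
    (dim rk : 'I_N -> nat) (G : tr_cores R dim rk) (n : 'I_N) :
    'M[R]_(num_cols dim n, rk (ordS n) * rk n) :=
  cyclic_unfold2 (subchain G n).

(* The columns of Q form an orthonormal basis of the column space of A. *)
Definition orthonormal_col_basis (R : realType) (p q r : nat)
    (A : 'M[R]_(p, q)) (Q : 'M[R]_(p, r)) : Prop :=
  Q^T *m Q = 1%:M /\ (Q^T == A^T)%MS.

Definition leverage_score (R : realType) (p q : nat) (A : 'M[R]_(p, q))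
    (i : 'I_p) : R :=
  let Q := xget (0 : 'M[R]_(p, \rank A)) [set Q | orthonormal_col_basis A Q] in
  \sum_j Q i j ^+ 2.

Lemma dot_row_gt0 (R : realType) (p : nat) (v : 'rV[R]_p) :
  v != 0 -> 0 < (v *m v^T) 0 0.
Proof.
move=> v0; have E : (v *m v^T) 0 0 = \sum_j v 0 j ^+ 2.
  by rewrite mxE; apply: eq_bigr => j _; rewrite mxE expr2.
rewrite E lt_neqAle sumr_ge0 ?andbT; last by move=> *; rewrite sqr_ge0.
apply: contra v0; rewrite eq_sym psumr_eq0; last by move=> *; rewrite sqr_ge0.
move=> /allP h; apply/eqP/rowP => j; rewrite mxE.
by have := h j (mem_index_enum j); rewrite sqrf_eq0 => /eqP.
Qed.

Lemma gram_schmidt (R : realType) (r p : nat) (B : 'M[R]_(r, p)) :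
  row_free B ->
  exists Q : 'M[R]_(r, p), Q *m Q^T = 1%:M /\ (Q == B)%MS.
Proof.
elim: r B => [|r IHr] B fB.
  exists 0; split; first by apply/matrixP => -[].
  by rewrite (flatmx0 B) submx_refl.
rewrite -[B](@vsubmxK _ 1 r p) in fB *.
set b := @usubmx _ 1 r p B in fB *; set B' := @dsubmx _ 1 r p B in fB *.
have fB' : row_free B'.
  rewrite -kermx_eq0; apply/rowV0P => w /sub_kermxP wB.
  have : row_mx (0 : 'M[R]_1) w *m col_mx b B' = 0.
    by rewrite mul_row_col mul0mx wB addr0.
  rewrite -(mul0mx _ (col_mx b B')) => /(row_free_inj fB).
  by rewrite -(@row_mx0 _ 1 1 r) => E; have [] := @eq_row_mx _ 1 1 r _ _ _ _ E.
have [Q [QQ QB]] := IHr _ fB'.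
pose v := b - b *m Q^T *m Q.
have vQ : v *m Q^T = 0.
  by rewrite /v mulmxBl -(mulmxA (b *m Q^T)) QQ mulmx1 subrr.
have v0 : v != 0.
  apply/eqP => E.
  have /submxP[D bD] : (b <= B')%MS.
    by rewrite -(eqmxP QB) (subr0_eq E) submxMl.
  have : row_mx (1 : 'M[R]_1) (- D) *m col_mx b B' = 0.
    by rewrite mul_row_col mul1mx mulNmx -bD subrr.
  rewrite -(mul0mx _ (col_mx b B')) => /(row_free_inj fB).
  rewrite -(@row_mx0 _ 1 1 r) => E2.
  have [/matrixP/(_ 0 0)] := @eq_row_mx _ 1 1 r _ _ _ _ E2.
  rewrite !mxE eqxx => /eqP.
  by rewrite oner_eq0.
have g0 := dot_row_gt0 v0; set g := (_ *m _) 0 0 in g0.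
pose c := (Num.sqrt g)^-1.
have c0 : c != 0 by rewrite invr_eq0 sqrtr_eq0 -ltNge.
have WW : col_mx (c *: v) Q *m (col_mx (c *: v) Q)^T = 1%:M.
  rewrite tr_col_mx mul_col_row QQ linearZ /= -!scalemxAl -!scalemxAr vQ.
  rewrite -[Q *m v^T]trmxK trmx_mul trmxK vQ trmx0 !scaler0.
  rewrite [v *m _]mx11_scalar -/g !scale_scalar_mx.
  have -> : c * (c * g) = 1.
    by rewrite mulrA -invfM -expr2 sqr_sqrtr ?ltW // mulVf ?gt_eqF.
  by rewrite -scalar_mx_block.
exists (col_mx (c *: v) Q); split; first exact: WW.
suff : (col_mx (c *: v) Q == col_mx b B')%MS by [].
have bS : (b <= col_mx b B')%MS by rewrite -addsmxE addsmxSl.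
have QS : (Q <= col_mx b B')%MS by rewrite (eqmxP QB) -addsmxE addsmxSr.
have QT : (Q <= col_mx (c *: v) Q)%MS by rewrite -addsmxE addsmxSr.
have -> : (col_mx (c *: v) Q <= col_mx b B')%MS.
  rewrite col_mx_sub QS andbT scalemx_sub // addmx_sub // eqmx_opp.
  exact: submx_trans (submxMl _ _) QS.
rewrite col_mx_sub -(eqmxP QB) QT andbT.
rewrite -[X in (X <= _)%MS](subrK (b *m Q^T *m Q)).
have cS : (c *: v <= col_mx (c *: v) Q)%MS by rewrite -addsmxE addsmxSl.
rewrite addmx_sub //; last exact: submx_trans (submxMl _ _) QT.
by rewrite -/v -[X in (X <= _)%MS](scalerK c0) (scalemx_sub _ cS).
Qed.

Lemma orthonormal_col_basis_exists (R : realType) (p q : nat)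
    (A : 'M[R]_(p, q)) :
  exists Q : 'M[R]_(p, \rank A), orthonormal_col_basis A Q.
Proof.
rewrite -mxrank_tr.
have [Q [QQ QA]] := gram_schmidt (row_base_free A^T).
exists Q^T; rewrite /orthonormal_col_basis trmxK; split=> //.
by apply/eqmxP/(eqmx_trans (eqmxP QA))/eq_row_base.
Qed.

Lemma leverage_scoreE (R : realType) (p q r : nat) (A : 'M[R]_(p, q))
    (Q : 'M[R]_(p, r)) (i : 'I_p) :
  orthonormal_col_basis A Q -> leverage_score A i = \sum_j Q i j ^+ 2.
Proof.
rewrite /leverage_score; set P := xget _ _ => -[QQ QA].
have [PP PA] : orthonormal_col_basis A P.
  by have := xgetPex 0 (orthonormal_col_basis_exists A).
have sumE (t : nat) (W : 'M[R]_(p, t)) :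
    \sum_j W i j ^+ 2 = (W *m W^T) i i.
  by rewrite mxE; apply: eq_bigr => j _; rewrite mxE expr2.
rewrite !sumE.
have projE (s t : nat) (V : 'M[R]_(p, s)) (W : 'M[R]_(p, t)) :
    V^T *m V = 1%:M -> (W^T <= V^T)%MS -> V *m V^T *m W = W.
  move=> VV /submxP[D]; move/(congr1 trmx); rewrite trmx_mul !trmxK => ->.
  by rewrite mulmxA -(mulmxA V) VV mulmx1.
have PQ : (P^T <= Q^T)%MS by rewrite (eqmxP PA) (eqmxP QA).
have QP : (Q^T <= P^T)%MS by rewrite (eqmxP PA) (eqmxP QA).
have E1 := projE _ _ _ _ QQ PQ; have E2 := projE _ _ _ _ PP QP.
have F1 : Q *m Q^T *m (P *m P^T) = P *m P^T by rewrite mulmxA E1.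
have F2 : P *m P^T *m (Q *m Q^T) = Q *m Q^T by rewrite mulmxA E2.
have symE (t : nat) (W : 'M[R]_(p, t)) : (W *m W^T)^T = W *m W^T.
  by rewrite trmx_mul trmxK.
by rewrite -F1 -(symE _ Q) -(symE _ P) -trmx_mul F2.
Qed.

Definition frobenius_norm (R : realType) (p q : nat) (A : 'M[R]_(p, q)) : R :=
  Num.sqrt (\sum_i \sum_j A i j ^+ 2).

Definition is_argmin (R : realType) (T : Type) (f : T -> R) (x : T) : Prop :=
  forall y, f x <= f y.

Lemma argmin_frobenius_exists (R : realType) (p q r : nat)
    (Y : 'M[R]_(p, q)) (B : 'M[R]_(q, r)) :
  exists H, is_argmin (fun H : 'M[R]_(p, r) => frobenius_norm (Y - H *m B^T)) H.
Proof.
have [Q [QQ QB]] := orthonormal_col_basis_exists B.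
have /submxP[H HE] : (Y *m Q *m Q^T <= B^T)%MS by rewrite -(eqmxP QB) submxMl.
exists H => K; rewrite -HE.
have normE (W : 'M[R]_(p, q)) : frobenius_norm W = Num.sqrt (\tr (W *m W^T)).
  congr Num.sqrt; apply: eq_bigr => i _; rewrite mxE.
  by apply: eq_bigr => j _; rewrite mxE expr2.
have tr_ge0 (W : 'M[R]_(p, q)) : 0 <= \tr (W *m W^T).
  apply: sumr_ge0 => i _; rewrite mxE; apply: sumr_ge0 => j _.
  by rewrite mxE -expr2 sqr_ge0.
rewrite !normE ler_sqrt ?tr_ge0 //.
set U := Y - Y *m Q *m Q^T.
have /submxP[D DE] : (Y *m Q *m Q^T - K *m B^T <= Q^T)%MS.
  by rewrite addmx_sub ?submxMl // eqmx_opp (eqmxP QB) submxMl.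
have UQ : U *m Q = 0 by rewrite /U mulmxBl -(mulmxA (Y *m Q)) QQ mulmx1 subrr.
have -> : Y - K *m B^T = U + D *m Q^T by rewrite -DE addrA subrK.
set W := D *m Q^T.
have UW : U *m W^T = 0 by rewrite trmx_mul trmxK mulmxA UQ mul0mx.
have WU : W *m U^T = 0 by rewrite -[LHS]trmxK trmx_mul trmxK UW trmx0.
have -> : (U + W) *m (U + W)^T = U *m U^T + W *m W^T.
  by rewrite raddfD /= mulmxDl !mulmxDr UW WU addr0 add0r.
by rewrite mxtraceD lerDl.
Qed.

Definition core_distribution (R : realType) (p d q : nat)
    (C : 'I_p -> 'I_d -> 'I_q -> R) (i : 'I_d) : R :=
  leverage_score (unfold2 C) i / (\rank (unfold2 C))%:R.

Definition sampling_distribution (R : realType) (N : nat)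
    (dim rk : 'I_N -> nat) (G : tr_cores R dim rk) (n : 'I_N)
    (j : 'I_(num_cols dim n)) : R :=
  if [pick a : multi_index dim | col_index n a == j] is Some a
  then \prod_(k < N | k != n) core_distribution (G k) (a k) else 0.

Arguments sampling_distribution {R N dim rk} G n j.

Lemma sampling_distributionE (R : realType) (N : nat)
    (dim rk : 'I_N -> nat) (G : tr_cores R dim rk) (n : 'I_N)
    (a : multi_index dim) :
  sampling_distribution G n (col_index n a) =
  \prod_(k < N | k != n) core_distribution (G k) (a k).
Proof.
rewrite /sampling_distribution.
case: pickP => [b /eqP Eb|/(_ a)]; last by rewrite eqxx.
by apply: eq_bigr => k kn; rewrite (col_index_inj Eb).
Qed.

(* m independent trials, each with values in 'I_J and with law q; [A i] may be
   the full set, so that the product rule covers every subfamily of trials. *)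
Record iid_trials (R : realType) (d : measure_display)
    (T : measurableType d) (P : probability T R) (m J : nat)
    (q : 'I_J -> R) (trial : 'I_m -> T -> 'I_J) : Prop := {
  trial_measurable : forall i (A : set 'I_J), measurable (trial i @^-1` A) ;
  trial_law : forall i j, P (trial i @^-1` [set j]) = (q j)%:E ;
  trial_independent : forall A : 'I_m -> set 'I_J,
    P (\bigcap_(i in [set: 'I_m]) (trial i @^-1` A i)) =
    (\prod_(i < m) P (trial i @^-1` A i))%E }.

(* [c i] is the index chosen in trial i. *)
Definition selection_matrix (R : realType) (m J : nat) (c : 'I_m -> 'I_J) :
    'M[R]_(m, J) :=
  \matrix_(i, j) (c i == j)%:R.

Definition rescaling_matrix (R : realType) (m J : nat) (q : 'I_J -> R)
    (c : 'I_m -> 'I_J) : 'M[R]_m :=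
  diag_mx (\row_i (Num.sqrt (m%:R * q (c i)))^-1).

Definition sampling_matrix (R : realType) (m J : nat) (q : 'I_J -> R)
    (c : 'I_m -> 'I_J) : 'M[R]_(m, J) :=
  rescaling_matrix q c *m selection_matrix R c.

(* Main.v *)
(** Matrix concentration is not needed: second moments suffice.

    Let B be the unfolded subchain tensor, with d columns and with an
    orthonormal column basis Q, S = Psi^T Psi, and let
    X' = X - X Q Q^T be the optimal residual.  The normal equations of the
    sketched problem say that its solution differs from the optimal one by
    W Q^T, where W (Q^T S Q) = X' S Q; hence the sketched solution has squared
    loss |X'|^2 + |W|^2, and |W|^2 <= 2 eps |X'|^2 as soon as
      V := |X' S Q|^2 / (eps |X'|^2) + 2 |Q^T S Q - I|^2 < 1.
    Combining both error terms in one quantity V, instead of bounding each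
    failure probability, is what makes Markov's inequality sharp enough.

    The columns of B lie in the span of the Kronecker product of the unfolded
    cores, so that |Q_j|^2 is at most the product of the leverage scores of
    the cores, which is at most K q_j with K = prod_(k <> n) R_k R_(k+1).
    Therefore E V <= (K d / m) (1 / eps + 2), and K d = prod_j R_j^2, so that
    m > 4 K d / (eps delta) gives E V <= delta. *)
Require Import Defs.
From HB Require Import structures.
From mathcomp Require Import all_boot all_order all_algebra.
From mathcomp Require Import all_classical all_reals all_analysis.
From mathcomp Require Import ring lra.
Set Implicit Arguments.
Unset Strict Implicit.
Unset Printing Implicit Defensive.
Import Order.TTheory GRing.Theory Num.Theory.
Local Open Scope classical_set_scope.
Local Open Scope ring_scope.

(** * Finite sums over sequences of independent draws *)

(** After expansion of the square, each cross term with two distinct trials contains the factor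
    [\sum_j q j * g j = 0], so the m diagonal terms remain. *)
Lemma sum_iid_sqr (R : comNzRingType) (m J : nat) (q g : 'I_J -> R) :
  \sum_j q j = 1 -> \sum_j q j * g j = 0 ->
  \sum_(c : {ffun 'I_m -> 'I_J}) (\prod_i q (c i)) * (\sum_i g (c i)) ^+ 2 =
  m%:R * \sum_j q j * g j ^+ 2.
Proof.
move=> q1 qg0.
under eq_bigr => c _ do
  (rewrite expr2 big_distrl big_distrr /=;
   under eq_bigr => i _ do (rewrite big_distrr big_distrr /=)).
rewrite exchange_big /=.
have -> : m%:R = \sum_(i < m) (1 : R) by rewrite sumr_const card_ord.
rewrite big_distrl; apply: eq_bigr => i _ /=; rewrite mul1r.
(* The two factors [g] are written as a product over all trials, with 1 elsewhere, so that the sum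
   over [c] of a product becomes a product of sums. *)
have termE (k : 'I_m) : \sum_(c : {ffun 'I_m -> 'I_J})
      (\prod_l q (c l)) * (g (c i) * g (c k)) =
    \prod_(l < m) \sum_j (q j * ((if l == i then g j else 1) *
                                 (if l == k then g j else 1))).
  rewrite [RHS]bigA_distr_bigA; apply: eq_bigr => c _; rewrite !big_split /=.
  by rewrite -!big_mkcond !big_pred1_eq.
rewrite exchange_big (bigD1 i) //= [X in _ + X]big1 ?addr0 => [|k ki].
  rewrite termE (bigD1 i) //= !eqxx [X in _ * X]big1 ?mulr1 => [|l li].
    by apply: eq_bigr => j _; rewrite expr2.
  by rewrite (negbTE li) -[RHS]q1; apply: eq_bigr => j _; rewrite !mulr1.
rewrite termE (bigD1 k) //= (negbTE ki) eqxx.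
by under eq_bigr => j _ do rewrite mul1r; rewrite qg0 mul0r.
Qed.

Lemma sum_prod_ffun1 (R : comNzRingType) (m J : nat) (q : 'I_J -> R) :
  \sum_j q j = 1 -> \sum_(c : {ffun 'I_m -> 'I_J}) \prod_i q (c i) = 1.
Proof.
move=> q1; rewrite -(bigA_distr_bigA (fun=> q)) big1 // => i _; exact: q1.
Qed.

(** Markov's inequality: where [V c < 1] fails, the weight of [c] is at most its weight times
    [V c]. *)
Lemma markov_ffun (R : realFieldType) (m J : nat) (q : 'I_J -> R)
    (V : {ffun 'I_m -> 'I_J} -> R) (delta : R) :
  (forall j, 0 <= q j) -> \sum_j q j = 1 -> (forall c, 0 <= V c) ->
  \sum_(c : {ffun 'I_m -> 'I_J}) (\prod_i q (c i)) * V c <= delta ->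
  1 - delta <= \sum_(c : {ffun 'I_m -> 'I_J} | V c < 1) \prod_i q (c i).
Proof.
move=> q0 q1 V0 Vd.
rewrite -[X in X - _](sum_prod_ffun1 m q1) (bigID [pred c | V c < 1]) /=.
rewrite -addrA gerDl subr_le0 (le_trans _ Vd) //.
rewrite big_mkcond; apply: ler_sum => c _.
have p0 : 0 <= \prod_i q (c i) by apply: prodr_ge0.
case: ltP => [_|/= V1]; first by rewrite mulr_ge0.
by rewrite ler_peMr.
Qed.

(** The event is a finite disjoint union of joint outcomes, and independence factors the probability
    of each. From here on all probabilities are finite sums. *)
Lemma iid_trials_prob (R : realType) (d : measure_display)
    (T : measurableType d) (P : probability T R) (m J : nat)
    (q : 'I_J -> R) (trial : 'I_m -> T -> 'I_J)
    (D : pred {ffun 'I_m -> 'I_J}) :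
  iid_trials P q trial ->
  P [set w | D [ffun i => trial i w]] = (\sum_(c | D c) \prod_i q (c i))%:E.
Proof.
move=> [tm tl ti].
pose F (c : {ffun 'I_m -> 'I_J}) :=
  \bigcap_(i in [set: 'I_m]) (trial i @^-1` [set c i]).
have FE w c : F c w <-> [ffun i => trial i w] = c.
  split=> [Fw|<- i _ /=]; last by rewrite ffunE.
  by apply/ffunP => i; rewrite ffunE; exact: Fw.
have mF c : measurable (F c).
  by apply: fin_bigcap_measurable => // i _; exact: tm.
have -> : [set w | D [ffun i => trial i w]] = \bigcup_(c in [set` D]) F c.
  apply/seteqP; split=> [w Dw|w [c Dc /FE cE]]; last by rewrite /= cE.
  by exists [ffun i => trial i w]; last exact/FE.
rewrite measure_fin_bigcup //; last first.
  by move=> c c' _ _ [w [/FE <- /FE <-]].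
rewrite -(bigfs _ (index_enum_uniq _)) => [|c _]; last by rewrite mem_index_enum.
rewrite -sumEFin; apply: eq_bigr => c _.
rewrite [LHS](ti (fun i => [set c i])) -prodEFin.
by apply: eq_bigr => i _; rewrite tl.
Qed.

(** The total mass of [q] is recovered from [(\sum_j q j) ^+ m = P setT = 1], where the base is
    nonnegative and m is positive. *)
Lemma iid_trials_distribution (R : realType) (d : measure_display)
    (T : measurableType d) (P : probability T R) (m J : nat)
    (q : 'I_J -> R) (trial : 'I_m -> T -> 'I_J) :
  (0 < m)%N -> iid_trials P q trial ->
  (forall j, 0 <= q j) /\ \sum_j q j = 1.
Proof.
move=> m0 trialP; have [tm tl _] := trialP.
have q0 j : 0 <= q j by rewrite -lee_fin -(tl (Ordinal m0)).
split=> //; have := iid_trials_prob predT trialP.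
rewrite (_ : [set w | _] = setT) ?probability_setT; last exact/seteqP.
rewrite -(bigA_distr_bigA (fun=> q)) prodr_const card_ord => /eqP.
rewrite eqe eq_sym pexprn_eq1 // ?sumr_ge0 //.
by rewrite eqn0Ngt m0 => /eqP.
Qed.

(** * Squared Frobenius norm and least squares *)

Definition sqfro (R : realType) (p q : nat) (A : 'M[R]_(p, q)) : R :=
  \sum_i \sum_j A i j ^+ 2.

Section SquaredFrobenius.
Variable R : realType.

Lemma sqfro_ge0 (p q : nat) (A : 'M[R]_(p, q)) : 0 <= sqfro A.
Proof. by apply: sumr_ge0 => i _; apply: sumr_ge0 => j _; rewrite sqr_ge0. Qed.

Lemma sqfro_eq0 (p q : nat) (A : 'M[R]_(p, q)) : (sqfro A == 0) = (A == 0).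
Proof.
apply/eqP/eqP => [|->]; last first.
  by rewrite /sqfro big1 // => i _; rewrite big1 // => j _; rewrite mxE expr0n.
have s0 (i : 'I_p) : 0 <= \sum_j A i j ^+ 2.
  by apply: sumr_ge0 => j _; rewrite sqr_ge0.
move/eqP; rewrite psumr_eq0 // => /allP h; apply/matrixP => i j; rewrite mxE.
have /= := h i (mem_index_enum i); rewrite psumr_eq0 => [/allP|k _]; last exact: sqr_ge0.
by move=> /(_ j (mem_index_enum j)); rewrite sqrf_eq0 => /eqP.
Qed.

Lemma sqfro_trace (p q : nat) (A : 'M[R]_(p, q)) : sqfro A = \tr (A *m A^T).
Proof.
apply: eq_bigr => i _; rewrite mxE.
by apply: eq_bigr => j _; rewrite mxE expr2.
Qed.

Lemma sqfro_sum_tr (p q : nat) (A : 'M[R]_(p, q)) :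
  sqfro A = \sum_j \sum_i A i j ^+ 2.
Proof. exact: exchange_big. Qed.

Lemma sqfroD_orth (p q : nat) (A B : 'M[R]_(p, q)) :
  A *m B^T = 0 -> sqfro (A + B) = sqfro A + sqfro B.
Proof.
move=> AB0; have BA0 : B *m A^T = 0 by rewrite -[LHS]trmxK trmx_mul trmxK AB0 trmx0.
rewrite !sqfro_trace raddfD /= mulmxDl !mulmxDr AB0 BA0 addr0 add0r.
by rewrite mxtraceD.
Qed.

Lemma sqfroMr_orth (p q r : nat) (A : 'M[R]_(p, r)) (Q : 'M[R]_(q, r)) :
  Q^T *m Q = 1%:M -> sqfro (A *m Q^T) = sqfro A.
Proof.
by move=> QQ; rewrite !sqfro_trace trmx_mul trmxK mulmxA -(mulmxA A) QQ mulmx1.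
Qed.

Lemma sqfroB_le (p q : nat) (A B : 'M[R]_(p, q)) :
  sqfro (A - B) <= 2 * (sqfro A + sqfro B).
Proof.
rewrite mulrDr !mulr_sumr -big_split; apply: ler_sum => i _ /=.
rewrite !mulr_sumr -big_split; apply: ler_sum => j _ /=.
rewrite !mxE -subr_ge0.
have -> : 2 * A i j ^+ 2 + 2 * B i j ^+ 2 - (A i j - B i j) ^+ 2 =
  (A i j + B i j) ^+ 2 by ring.
exact: sqr_ge0.
Qed.

(** Lagrange's identity: the double sum of the squares of [a i * b j - a j * b i] is twice the
    difference of the two sides. *)
Lemma cauchy_schwarz_sum (I : finType) (a b : I -> R) :
  (\sum_i a i * b i) ^+ 2 <= (\sum_i a i ^+ 2) * (\sum_i b i ^+ 2).
Proof.
have : 0 <= \sum_i \sum_j (a i * b j - a j * b i) ^+ 2.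
  by apply: sumr_ge0 => i _; apply: sumr_ge0 => j _; rewrite sqr_ge0.
have -> : \sum_i \sum_j (a i * b j - a j * b i) ^+ 2 =
  (\sum_i a i ^+ 2) * (\sum_i b i ^+ 2) +
  (\sum_i b i ^+ 2) * (\sum_i a i ^+ 2) -
  2 * ((\sum_i a i * b i) * (\sum_i a i * b i)).
  rewrite !big_distrlr /= mulr_sumr -big_split -sumrB; apply: eq_bigr => i _ /=.
  rewrite mulr_sumr -big_split -sumrB; apply: eq_bigr => j _ /=; ring.
by rewrite expr2; nra.
Qed.

Lemma sqfroM_le (p q r : nat) (A : 'M[R]_(p, q)) (B : 'M[R]_(q, r)) :
  sqfro (A *m B) <= sqfro A * sqfro B.
Proof.
rewrite (sqfro_sum_tr B) mulr_suml; apply: ler_sum => i _.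
rewrite mulr_sumr; apply: ler_sum => j _.
by rewrite mxE cauchy_schwarz_sum.
Qed.

Lemma frobenius_normE (p q : nat) (A : 'M[R]_(p, q)) :
  frobenius_norm A = Num.sqrt (sqfro A).
Proof. by []. Qed.

Lemma frobenius_norm_le (p q s t : nat) (A : 'M[R]_(p, q)) (B : 'M[R]_(s, t)) :
  (frobenius_norm A <= frobenius_norm B) = (sqfro A <= sqfro B).
Proof. by rewrite !frobenius_normE ler_sqrt // sqfro_ge0. Qed.

(** Moving [H] by [t *: F], where [F] is minus half the gradient of the squared loss, changes that
    loss by a quadratic in t with linear coefficient [- 2 * sqfro F]; minimality forces [F = 0]. *)
Lemma normal_equations (p q r : nat) (Y : 'M[R]_(p, q)) (B : 'M[R]_(q, r))
    (H : 'M[R]_(p, r)) :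
  is_argmin (fun H => frobenius_norm (Y - H *m B^T)) H ->
  (Y - H *m B^T) *m B = 0.
Proof.
move=> Hmin; set E := Y - H *m B^T; set F := E *m B.
have mono (t : R) : 0 <= t ^+ 2 * sqfro (F *m B^T) - 2 * t * sqfro F.
  have := Hmin (H + t *: F); rewrite frobenius_norm_le => h.
  rewrite -subr_ge0 -/E in h; rewrite [X in _ <= X](_ : _ =
    sqfro (Y - (H + t *: F) *m B^T) - sqfro E) //.
  have -> : Y - (H + t *: F) *m B^T = E - t *: (F *m B^T).
    by rewrite mulmxDl opprD addrA -scalemxAl.
  have FE : \tr (E *m (F *m B^T)^T) = sqfro F.
    by rewrite trmx_mul trmxK mulmxA sqfro_trace.
  have EF : \tr (F *m B^T *m E^T) = sqfro F.
    by rewrite -mxtrace_tr trmx_mul trmxK FE.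
  rewrite (sqfro_trace (E - _)) (sqfro_trace (F *m _)) (sqfro_trace E).
  rewrite [(E - _)^T]raddfB /= [(t *: _)^T]linearZ /= mulmxBl !mulmxBr
    -!scalemxAl -!scalemxAr.
  rewrite !(raddfB (@mxtrace R p)) /= !mxtraceZ FE EF; ring.
apply/eqP; rewrite -sqfro_eq0 eq_le sqfro_ge0 andbT.
have b0 := sqfro_ge0 (F *m B^T); have f0 := sqfro_ge0 F.
set b := sqfro (F *m B^T) in mono b0 *; set f := sqfro F in mono f0 *.
have b1 : 0 < b + 1 by lra.
(* The quadratic is smallest at [f / b], but b may vanish; the denominator [b + 1] is safe and still
   gives a negative value unless [f = 0]. *)
have := mono (f / (b + 1)).
have -> : (f / (b + 1)) ^+ 2 * b - 2 * (f / (b + 1)) * f =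
  - (f ^+ 2 * (b + 2)) / (b + 1) ^+ 2 by field; lra.
rewrite pmulr_lge0 ?invr_gt0 ?exprn_gt0 // oppr_ge0; nra.
Qed.

(** Pythagoras: the residual of the projection onto the row space of [Q^T] is orthogonal to every
    matrix [W *m Q^T]. *)
Lemma sqfro_residual (p J r d : nat) (Y : 'M[R]_(p, J)) (B : 'M[R]_(J, d))
    (Q : 'M[R]_(J, r)) (H : 'M[R]_(p, d)) :
  orthonormal_col_basis B Q ->
  exists2 W : 'M[R]_(p, r), H *m B^T = (Y *m Q + W) *m Q^T &
    sqfro (Y - H *m B^T) = sqfro (Y - Y *m Q *m Q^T) + sqfro W.
Proof.
move=> [QQ QB].
have /submxP[C BC] : (B^T <= Q^T)%MS by rewrite (eqmxP QB).
exists (H *m C - Y *m Q); first by rewrite addrC subrK BC mulmxA.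
have -> : Y - H *m B^T = (Y - Y *m Q *m Q^T) - (H *m C - Y *m Q) *m Q^T.
  by rewrite mulmxBl opprB addrA subrK BC mulmxA.
have XQ : (Y - Y *m Q *m Q^T) *m Q = 0.
  by rewrite mulmxBl -(mulmxA (Y *m Q)) QQ mulmx1 subrr.
rewrite -[X in sqfro (_ + X)]mulNmx sqfroD_orth; last first.
  by rewrite trmx_mul trmxK mulmxA XQ mul0mx.
rewrite sqfroMr_orth //; congr (_ + _).
by apply: eq_bigr => i _; apply: eq_bigr => j _; rewrite [in LHS]mxE sqrrN.
Qed.

Lemma sketched_least_squares (p J r d m : nat) (Y : 'M[R]_(p, J))
    (B : 'M[R]_(J, d)) (Q : 'M[R]_(J, r)) (Psi : 'M[R]_(m, J)) (eps : R)
    (H : 'M[R]_(p, d)) :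
  let X := Y - Y *m Q *m Q^T in
  let S := Psi^T *m Psi in
  0 < eps ->
  orthonormal_col_basis B Q ->
  is_argmin (fun H => frobenius_norm (Y *m Psi^T - H *m (Psi *m B)^T)) H ->
  (eps * sqfro X)^-1 * sqfro (X *m S *m Q) +
    2 * sqfro (Q^T *m S *m Q - 1%:M) < 1 ->
  sqfro (Y - H *m B^T) <= (1 + 2 * eps) * sqfro X.
Proof.
move=> X S eps0 QB /normal_equations Hn small.
have [W HW ->] := sqfro_residual Y H QB.
have [QQ /eqmxP QBs] := QB.
have /submxP[D QD] : (Q^T <= B^T)%MS by rewrite QBs.
(* Since [Q = B *m D^T], multiplying the sketched normal equations by [D^T] on the right replaces
   the last [B] by [Q]. *)
have WA : W *m (Q^T *m S *m Q) = X *m S *m Q.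
  have QE : Q = B *m D^T by rewrite -[LHS]trmxK QD trmx_mul trmxK.
  apply/eqP; rewrite eq_sym -subr_eq0; apply/eqP.
  transitivity ((Y *m Psi^T - H *m (Psi *m B)^T) *m (Psi *m B) *m D^T);
    last by rewrite Hn mul0mx.
  rewrite [(Psi *m B)^T]trmx_mul (mulmxA H) HW -mulmxBl -!mulmxA.
  rewrite -QE (mulmxA Psi^T) -/S mulmxBl mulmxDl opprD addrA !mulmxA.
  by rewrite !mulmxBl.
set E := _ - 1%:M in small.
have {}WA : W = X *m S *m Q - W *m E.
  by rewrite /E mulmxBr mulmx1 WA opprB addrC subrK.
have := sqfroB_le (X *m S *m Q) (W *m E); rewrite -WA.
have := sqfroM_le W E; have := sqfro_ge0 W; have := sqfro_ge0 E.
(* If the optimal residual is zero, the first error term vanishes and [2 * sqfro E < 1] alone forces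
   [W = 0]. *)
have := sqfro_ge0 X; rewrite le_eqVlt => /orP[/eqP X0|X0].
  have XS : sqfro (X *m S *m Q) = 0.
    have /eqP -> : X == 0 by rewrite -sqfro_eq0 -X0.
    by apply/eqP; rewrite sqfro_eq0 !mul0mx.
  move: small; rewrite XS -X0 !mulr0 add0r; nra.
have eX : 0 < eps * sqfro X by rewrite mulr_gt0.
move: small; rewrite mulrC -ltrBrDr ltr_pdivrMr //.
set e := sqfro E; set w := sqfro W; set s := sqfro (_ *m Q).
set x := sqfro X in X0 eX *; set we := sqfro (W *m E).
move=> h e0 w0 we_le w_le.
(* The smallness hypothesis now reads [s < (1 - 2 * e) * (eps * x)], so the positive factor
   [1 - 2 * e] can be cancelled. *)
have h1 : w * (1 - 2 * e) <= 2 * s by lra.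
suff : w <= 2 * (eps * x) by lra.
have s0 : 0 <= s by exact: sqfro_ge0.
have e1 : 0 < 1 - 2 * e by nra.
by rewrite -(ler_pM2r e1); nra.
Qed.

End SquaredFrobenius.

(** * Sums over multi-indices and linear maps that fix slice chains *)

(** Distributivity with ranges that depend on the factor: passing to [fprod] makes them subsets of a
    single tagged type. *)
Lemma sum_prod_multi_index (R : comNzRingType) (N : nat) (dim : 'I_N -> nat)
    (F : forall k : 'I_N, 'I_(dim k) -> R) :
  \sum_(a : multi_index dim) \prod_k F k (a k) = \prod_k \sum_i F k i.
Proof.
pose T_ (k : 'I_N) : finType := 'I_(dim k).
pose G (k : 'I_N) : {ffun T_ k -> R} := [ffun i => F k i].
transitivity (\sum_(t : fprod T_) \prod_k G k (t k)).
  rewrite (reindex (@dffun_of_fprod _ T_)) /=; last first.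
    exact/onW_bij/dffun_of_fprod_bij.
  by apply: eq_bigr => t _; apply: eq_bigr => k _; rewrite !ffunE.
have tagE k : \sum_i F k i = \sum_(j in tagged_with T_ k) untag 0 (G k) j.
  transitivity (\sum_(i : T_ k) G k i); last exact: (big_tag (fun k i => G k i)).
  by apply: eq_bigr => i _; rewrite ffunE.
under [RHS]eq_bigr => k _ do rewrite tagE.
by rewrite bigA_distr_big_dep; exact: (big_fprod _ _ G).
Qed.

(** Fixing the n-th component selects exactly one multi-index per column; the indicator weight keeps
    the sum in a form to which distributivity applies. *)
Lemma sum_num_cols (R : comNzRingType) (N : nat) (dim : 'I_N -> nat)
    (n : 'I_N) (i0 : 'I_(dim n)) (f : 'I_(num_cols dim n) -> R) :
  \sum_j f j = \sum_(a : multi_index dim) (a n == i0)%:R * f (col_index n a).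
Proof.
pose g (a : multi_index dim) := col_index n a.
rewrite (partition_big g predT) //=; apply: eq_bigr => j _.
have [a an aj] := col_index_surj i0 j.
rewrite (bigD1 a) /=; last by rewrite /g aj.
rewrite an eqxx mul1r aj big1 ?addr0 // => b /andP[/eqP bj ba].
case: (eqVneq (b n) i0) => [bn|_]; last by rewrite mul0r.
case/eqP: ba; apply/ffunP => k.
by case: (eqVneq k n) => [->|]; [rewrite bn an|apply: col_index_inj; rewrite aj].
Qed.

(* The partially contracted form, with arbitrary weights [phi] on the modes
   outside [s], makes the induction along a chain of slices go through. *)
Definition fixed_on (R : comNzRingType) (N : nat) (dim : 'I_N -> nat)
    (Pi : forall k : 'I_N, 'M[R]_(dim k)) (s : seq 'I_N)
    (f : multi_index dim -> R) : Prop :=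
  forall (a : multi_index dim) (phi : forall k : 'I_N, 'I_(dim k) -> R),
  \sum_(b : multi_index dim)
     (\prod_k if k \in s then Pi k (a k) (b k) else phi k (b k)) * f b =
  f a * \prod_(k | k \notin s) \sum_i phi k i.

Section FixedOn.
Variables (R : comNzRingType) (N : nat) (dim : 'I_N -> nat).
Variable Pi : forall k : 'I_N, 'M[R]_(dim k).

Lemma fixed_on_cst (c : R) : fixed_on Pi [::] (fun=> c).
Proof.
move=> a phi; rewrite -big_distrl mulrC /=; congr (_ * _).
exact: sum_prod_multi_index.
Qed.

Lemma fixed_on_sum (I : Type) (r : seq I) (s : seq 'I_N)
    (f : I -> multi_index dim -> R) :
  (forall i, fixed_on Pi s (f i)) ->
  fixed_on Pi s (fun a => \sum_(i <- r) f i a).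
Proof.
move=> fs a phi /=; rewrite mulr_suml.
under [LHS]eq_bigr => b _ do rewrite mulr_sumr.
by rewrite exchange_big /=; apply: eq_bigr => i _; exact: fs.
Qed.

(** The factor [g (a l)] is absorbed into the weight of mode [l], which is still arbitrary because
    [l] is outside [s]. *)
Lemma fixed_onM (s : seq 'I_N) (f : multi_index dim -> R) (l : 'I_N)
    (g : 'I_(dim l) -> R) :
  l \notin s -> fixed_on Pi s f ->
  (forall i, \sum_j Pi l i j * g j = g i) ->
  fixed_on Pi (rcons s l) (fun a => f a * g (a l)).
Proof.
move=> ls fs gl a phi.
pose psi := dfwith phi l (fun j => Pi l (a l) j * g j).
transitivity (f a * \prod_(k | k \notin s) \sum_i psi k i).
  rewrite -fs; apply: eq_bigr => b _; rewrite mulrCA mulrC; congr (_ * _).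
  rewrite (bigD1 l) //= [RHS](bigD1 l) //= mem_rcons inE eqxx (negbTE ls) /=.
  rewrite /psi dfwithin [LHS]mulrAC; congr (_ * _).
  apply: eq_bigr => k kl; rewrite mem_rcons inE (negbTE kl) /=.
  by rewrite dfwithout // eq_sym.
rewrite -mulrA; congr (_ * _); rewrite (bigD1 l) //= /psi dfwithin gl.
congr (_ * _); apply: eq_big => [k|k /andP[_ kl]].
  by rewrite mem_rcons inE negb_or andbC.
by apply: eq_bigr => i _; rewrite dfwithout // eq_sym.
Qed.

End FixedOn.

Lemma iter_ordS_inj (N : nat) (k : 'I_N) (s t : nat) :
  (s < N)%N -> (t < N)%N -> iter s (@ordS N) k = iter t (@ordS N) k -> s = t.
Proof.
move=> sN tN /(congr1 val); rewrite !iter_ordS_val => /eqP.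
by rewrite eqn_modDl !modn_small // => /eqP.
Qed.

(** The N iterates starting at [ordS n] are distinct, hence exhaust ['I_N], and the last of them is
    [n]. *)
Lemma mem_traject_ordS (N : nat) (n k : 'I_N) :
  (k \in traject (@ordS N) (ordS n) N.-1) = (k != n).
Proof.
have N0 : (0 < N)%N := leq_ltn_trans (leq0n _) (ltn_ord n).
have NE := prednK N0.
have u : uniq (traject (@ordS N) (ordS n) N).
  rewrite -[X in traject _ _ X]NE looping_uniq; apply/trajectP => -[i iN].
  have NN : (N.-1 < N)%N by rewrite NE.
  by move=> /(iter_ordS_inj NN (ltn_trans iN NN)) E; rewrite E ltnn in iN.
have full : k \in traject (@ordS N) (ordS n) N.
  have sub : {subset traject (@ordS N) (ordS n) N <= enum 'I_N}.
    by move=> l _; rewrite mem_enum.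
  have [|_ ->] := uniq_min_size u sub; last by rewrite mem_enum.
  by rewrite size_traject size_enum_ord.
have TE : traject (@ordS N) (ordS n) N =
    rcons (traject (@ordS N) (ordS n) N.-1) n.
  by rewrite -[X in traject _ _ X]NE trajectSr iter_ordS_full.
move: u full; rewrite TE rcons_uniq mem_rcons inE => /andP[nin _].
by case: eqVneq => [->|_ /= ->] //; rewrite (negbTE nin).
Qed.

(** An entry of the chain is a sum of products in which each further slice brings a new mode;
    [t <= N] ensures that no mode recurs. *)
Lemma fixed_on_slice_chain (R : realType) (N : nat) (dim rk : 'I_N -> nat)
    (G : tr_cores R dim rk) (Pi : forall k : 'I_N, 'M[R]_(dim k)) (k : 'I_N)
    (t : nat) u v :
  (forall l u v i, \sum_j Pi l i j * G l u j v = G l u i v) ->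
  (t <= N)%N ->
  fixed_on Pi (traject (@ordS N) k t) (fun a => slice_chain G a k t u v).
Proof.
move=> PG; elim: t u v => [|t IHt] u v tN; first exact: fixed_on_cst.
pose l := iter t (@ordS N) k.
have E (a : multi_index dim) : slice_chain G a k t.+1 u v =
    \sum_w slice_chain G a k t u w * G l w (a l) v.
  by rewrite /= mxE; apply: eq_bigr => w _; rewrite [lateral_slice _ _ _ _]mxE.
rewrite (_ : (fun a => _) = fun a => \sum_w slice_chain G a k t u w * G l w (a l) v);
  last by apply/funext.
apply: fixed_on_sum => w; rewrite trajectSr.
apply: (@fixed_onM _ _ _ _ _ (fun a => slice_chain G a k t u w) l (fun i => G l w i v)).
- apply/trajectP => -[i it] /(iter_ordS_inj tN (ltn_trans it tN)) E'.
  by rewrite E' ltnn in it.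
- exact/IHt/ltnW.
- by move=> i; exact: PG.
Qed.

(** * Leverage scores of the subchain against those of the cores *)

(** Leverage scores are the diagonal of [Q *m Q^T]. As [P] fixes [Q], the difference [D] of the two
    projections is again an orthogonal projection, and [D = D *m D^T] has a nonnegative diagonal. *)
Lemma leverage_score_le_proj (R : realType) (p q : nat) (A : 'M[R]_(p, q))
    (P : 'M[R]_p) (i : 'I_p) :
  P^T = P -> P *m P = P -> P *m A = A -> leverage_score A i <= P i i.
Proof.
move=> Psym Pidem PA; have [Q QA] := orthonormal_col_basis_exists A.
rewrite (leverage_scoreE _ QA); have [QQ /eqmxP QAs] := QA.
have PQ : P *m Q = Q.
  have /submxP[D QD] : (Q^T <= A^T)%MS by rewrite QAs.
  have -> : Q = A *m D^T by rewrite -[LHS]trmxK QD trmx_mul trmxK.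
  by rewrite mulmxA PA.
have QP : Q^T *m P = Q^T by rewrite -[LHS]trmxK trmx_mul trmxK Psym PQ.
pose D := P - Q *m Q^T.
have DD : D *m D^T = D.
  rewrite /D raddfB /= trmx_mul trmxK Psym mulmxBl !mulmxBr Pidem.
  rewrite (mulmxA P) PQ -(mulmxA Q Q^T P) QP -(mulmxA Q Q^T) (mulmxA Q^T) QQ.
  by rewrite mul1mx subrr subr0.
rewrite -subr_ge0 (_ : _ - _ = D i i).
  rewrite -DD mxE sumr_ge0 // => j _.
  by rewrite [D^T _ _]mxE -expr2 sqr_ge0.
rewrite !mxE; congr (_ - _); apply: eq_bigr => j _.
by rewrite mxE expr2.
Qed.

Lemma unfold2E (R : realType) (p d q : nat) (C : 'I_p -> 'I_d -> 'I_q -> R)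
    (u : 'I_p) (i : 'I_d) (v : 'I_q) :
  unfold2 C i (mxvec_index v u) = C u i v.
Proof. by rewrite mxE mxvecE !mxE. Qed.

Lemma subchain_unfoldingE (R : realType) (N : nat) (dim rk : 'I_N -> nat)
    (G : tr_cores R dim rk) (n : 'I_N) (a : multi_index dim) u v :
  subchain_unfolding G n (col_index n a) (mxvec_index u v) =
  slice_chain G a (ordS n) N.-1 u
    (cast_ord (esym (congr1 rk (iter_ordS_full n))) v).
Proof.
rewrite mxE mxvecE subchainE castmxE /=; congr (slice_chain _ _ _ _ _ _).
exact: val_inj.
Qed.

Section ColumnProjection.
Variables (R : realType) (N : nat) (dim rk : 'I_N -> nat) (n : 'I_N).
(** A representative multi-index for each column, determined by the column outside mode [n]; [a0]
    supplies a value in mode [n]. *)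
Variable lift : 'I_(num_cols dim n) -> multi_index dim.
Hypothesis liftK : cancel lift (@col_index N dim n).
Variable a0 : multi_index dim.

Lemma lift_col_index (a : multi_index dim) (k : 'I_N) :
  k != n -> lift (col_index n a) k = a k.
Proof. by apply: col_index_inj; rewrite liftK. Qed.

Lemma sum_delta (k : 'I_N) : \sum_(i < dim k) (i == a0 k)%:R = 1 :> R.
Proof.
by rewrite (bigD1 (a0 k)) //= eqxx big1 ?addr0 // => i /negbTE ->.
Qed.

Lemma sum_lift_prod (F : forall k : 'I_N, 'I_(dim k) -> R) :
  \sum_j \prod_(k | k != n) F k (lift j k) = \prod_(k | k != n) \sum_i F k i.
Proof.
pose H k i := if k == n then (i == a0 k)%:R else F k i.
rewrite (sum_num_cols (a0 n)).
transitivity (\prod_k \sum_i H k i).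
  rewrite -sum_prod_multi_index; apply: eq_bigr => a _.
  rewrite [RHS](bigD1 n) //= /H eqxx; congr (_ * _).
  by apply: eq_bigr => k kn; rewrite lift_col_index // (negbTE kn).
rewrite (bigD1 n) //= /H eqxx sum_delta mul1r.
by apply: eq_bigr => k /negbTE ->.
Qed.

(** The Kronecker product of the [Pi k] with [k != n], in the row order of the subchain
    unfolding. *)
Definition col_projection (Pi : forall k : 'I_N, 'M[R]_(dim k)) :
    'M[R]_(num_cols dim n) :=
  \matrix_(i, j) \prod_(k | k != n) Pi k (lift i k) (lift j k).

Lemma col_projection_idem (Pi : forall k : 'I_N, 'M[R]_(dim k)) :
  (forall k, Pi k *m Pi k = Pi k) ->
  col_projection Pi *m col_projection Pi = col_projection Pi.
Proof.
move=> Pidem; apply/matrixP => i j; rewrite !mxE.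
under [LHS]eq_bigr => l _ do rewrite !mxE -big_split /=.
rewrite (sum_lift_prod (fun k l => Pi k (lift i k) l * Pi k l (lift j k))).
by apply: eq_bigr => k _; rewrite -[in RHS]Pidem mxE.
Qed.

Lemma col_projection_subchain (Pi : forall k : 'I_N, 'M[R]_(dim k))
    (G : tr_cores R dim rk) :
  (forall l u v i, \sum_j Pi l i j * G l u j v = G l u i v) ->
  col_projection Pi *m subchain_unfolding G n = subchain_unfolding G n.
Proof.
move=> PG; apply/matrixP => j c; rewrite mxE.
case/mxvec_indexP: c => u v; rewrite (sum_num_cols (a0 n)) -(liftK j).
set v' := cast_ord (esym (congr1 rk (iter_ordS_full n))) v.
(* The free weight on mode [n] is the indicator of [a0 n]: it sums to 1 and reduces the sum over
   multi-indices to one over columns. *)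
have := fixed_on_slice_chain u v' PG (leq_pred N)
  (lift j) (fun k i => (i == a0 k)%:R).
rewrite [X in _ * X]big1 ?mulr1 => [|k _]; last exact: sum_delta.
rewrite -subchain_unfoldingE => <-; apply: eq_bigr => b _.
rewrite mulrA -subchain_unfoldingE; congr (_ * _).
rewrite liftK mxE [RHS](bigD1 n) //= mem_traject_ordS eqxx; congr (_ * _).
by apply: eq_bigr => k kn; rewrite mem_traject_ordS kn lift_col_index.
Qed.

End ColumnProjection.

Lemma leverage_score_ge0 (R : realType) (p q : nat) (A : 'M[R]_(p, q))
    (i : 'I_p) : 0 <= leverage_score A i.
Proof. by apply: sumr_ge0 => j _; rewrite sqr_ge0. Qed.

(** The Kronecker product of the projections onto the column spaces of the unfolded cores fixes the
    subchain unfolding, and its diagonal is the product of their leverage scores. *)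
Lemma leverage_score_subchain_le (R : realType) (N : nat)
    (dim rk : 'I_N -> nat) (G : tr_cores R dim rk) (n : 'I_N)
    (a : multi_index dim) :
  leverage_score (subchain_unfolding G n) (col_index n a) <=
  \prod_(k | k != n) leverage_score (unfold2 (G k)) (a k).
Proof.
have /choice[lift liftK] : forall j, exists b, @col_index N dim n b = j.
  by move=> j; have [b _ <-] := col_index_surj (a n) j; exists b.
pose Q k := projT1 (cid (orthonormal_col_basis_exists (unfold2 (G k)))).
have QP k : orthonormal_col_basis (unfold2 (G k)) (Q k) := projT2 (cid _).
pose Pi k := Q k *m (Q k)^T.
have Pisym k : (Pi k)^T = Pi k by rewrite trmx_mul trmxK.
have Piidem k : Pi k *m Pi k = Pi k.
  by rewrite mulmxA -(mulmxA (Q k)) (QP k).1 mulmx1.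
have PiG l u v i : \sum_j Pi l i j * G l u j v = G l u i v.
  transitivity ((Pi l *m unfold2 (G l)) i (mxvec_index v u)).
    by rewrite mxE; apply: eq_bigr => j _; rewrite unfold2E.
  have [QQ /eqmxP QG] := QP l.
  have /submxP[D GD] : ((unfold2 (G l))^T <= (Q l)^T)%MS by rewrite QG.
  have GE : unfold2 (G l) = Q l *m D^T by rewrite -[LHS]trmxK GD trmx_mul trmxK.
  by rewrite -unfold2E GE mulmxA -(mulmxA (Q l)) QQ mulmx1.
apply: le_trans (leverage_score_le_proj _ _
  (col_projection_idem liftK a Piidem) (col_projection_subchain liftK a PiG)) _.
  apply/matrixP => i j; rewrite !mxE; apply: eq_bigr => k _.
  by rewrite -[in LHS]Pisym mxE.
rewrite mxE; apply: ler_prod => k kn; rewrite lift_col_index //.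
rewrite (leverage_scoreE _ (QP k)) mxE.
have -> : \sum_j Q k (a k) j * (Q k)^T j (a k) = \sum_j Q k (a k) j ^+ 2.
  by apply: eq_bigr => j _; rewrite mxE expr2.
by rewrite lexx sumr_ge0 // => j _; rewrite sqr_ge0.
Qed.

(** The score is the rank times its normalized value, and the rank is at most the number of columns;
    a nonzero core makes the rank positive. *)
Lemma leverage_score_le_core_distribution (R : realType) (p d q : nat)
    (C : 'I_p -> 'I_d -> 'I_q -> R) (i : 'I_d) :
  (exists u i v, C u i v != 0) ->
  leverage_score (unfold2 C) i <= p%:R * q%:R * core_distribution C i.
Proof.
move=> [u [i' [v C0]]]; rewrite /core_distribution mulrA ler_pdivlMr; last first.
  rewrite ltr0n lt0n mxrank_eq0; apply: contra C0 => /eqP C0.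
  by rewrite -unfold2E C0 mxE.
rewrite mulrC ler_wpM2r ?leverage_score_ge0 // -natrM ler_nat [leqRHS]mulnC.
exact: rank_leq_col.
Qed.

Lemma leverage_score_le_sampling_distribution (R : realType) (N : nat)
    (dim rk : 'I_N -> nat) (G : tr_cores R dim rk) (n : 'I_N)
    (j : 'I_(num_cols dim n)) :
  (forall k, exists u i v, G k u i v != 0) ->
  leverage_score (subchain_unfolding G n) j <=
  (\prod_(k | k != n) ((rk k)%:R * (rk (ordS k))%:R)) *
    sampling_distribution G n j.
Proof.
move=> G0; have [u [i0 [v _]]] := G0 n.
have [a _ <-] := col_index_surj i0 j.
apply: (le_trans (leverage_score_subchain_le G n a)).
rewrite sampling_distributionE -big_split; apply: ler_prod => k _.
by rewrite leverage_score_ge0 leverage_score_le_core_distribution.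
Qed.

(** * Variance of sampled matrix products *)

Lemma sampling_matrixE (R : realType) (m J : nat) (q : 'I_J -> R)
    (c : 'I_m -> 'I_J) (t : 'I_m) (j : 'I_J) :
  sampling_matrix q c t j = (c t == j)%:R / Num.sqrt (m%:R * q (c t)).
Proof. by rewrite /sampling_matrix mul_diag_mx !mxE mulrC. Qed.

Lemma sampled_productE (R : realType) (m J p r : nat) (q : 'I_J -> R)
    (c : 'I_m -> 'I_J) (A : 'M[R]_(p, J)) (C : 'M[R]_(J, r)) i l :
  (forall j, 0 <= q j) ->
  (A *m ((sampling_matrix q c)^T *m sampling_matrix q c) *m C) i l =
  m%:R^-1 * \sum_t A i (c t) * C (c t) l / q (c t).
Proof.
move=> q0; rewrite mulmxA -mulmxA mxE mulr_sumr; apply: eq_bigr => t _.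
have -> : (A *m (sampling_matrix q c)^T) i t =
    A i (c t) / Num.sqrt (m%:R * q (c t)).
  rewrite mxE (bigD1 (c t)) //= mxE sampling_matrixE eqxx mul1r.
  rewrite big1 ?addr0 // => j /negbTE jc.
  by rewrite mxE sampling_matrixE eq_sym jc mul0r mulr0.
have -> : (sampling_matrix q c *m C) t l =
    C (c t) l / Num.sqrt (m%:R * q (c t)).
  rewrite mxE (bigD1 (c t)) //= sampling_matrixE eqxx mul1r mulrC.
  rewrite big1 ?addr0 // => j /negbTE jc.
  by rewrite sampling_matrixE eq_sym jc !mul0r.
rewrite mulrACA -invfM -expr2 sqr_sqrtr ?mulr_ge0 // invfM.
by rewrite mulrCA.
Qed.

(* Unbiased Monte Carlo estimation of [A *m C]: the variance of an entry is at
   most 1/m times the second moment of one sample. *)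
Lemma expected_sampled_product_error (R : realType) (m J p r : nat)
    (q : 'I_J -> R) (K : R) (A : 'M[R]_(p, J)) (C : 'M[R]_(J, r)) :
  (0 < m)%N -> 0 <= K -> (forall j, 0 <= q j) -> \sum_j q j = 1 ->
  (forall j, \sum_l C j l ^+ 2 <= K * q j) ->
  \sum_(c : {ffun 'I_m -> 'I_J}) (\prod_t q (c t)) *
    sqfro (A *m ((sampling_matrix q c)^T *m sampling_matrix q c) *m C - A *m C)
  <= K / m%:R * sqfro A.
Proof.
move=> m0 K0 q0 q1 CK; have m0' : m%:R != 0 :> R by rewrite pnatr_eq0 -lt0n.
(* An index of probability zero has a zero row in [C], so the value 0 given by division by zero in
   [y] is the right one. *)
have C0 j l : q j = 0 -> C j l = 0.
  move=> qj; have := CK j; rewrite qj mulr0 => sC.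
  have : \sum_l C j l ^+ 2 == 0.
    by rewrite eq_le sC sumr_ge0 // => k _; rewrite sqr_ge0.
  rewrite psumr_eq0 => [/allP/(_ l (mem_index_enum l))|k _]; last exact: sqr_ge0.
  by rewrite sqrf_eq0 => /eqP.
pose y i l j := A i j * C j l / q j.
have qy i l j : q j * y i l j = A i j * C j l.
  rewrite /y; case: (eqVneq (q j) 0) => [qj|qj]; last by rewrite mulrC divfK.
  by rewrite (C0 _ _ qj) !(mulr0, mul0r).
pose mu i l := (A *m C) i l.
pose g i l j := y i l j - mu i l.
have qg0 i l : \sum_j q j * g i l j = 0.
  under [LHS]eq_bigr => j _ do rewrite mulrBr qy.
  by rewrite sumrB -mulr_suml q1 mul1r /mu mxE subrr.
have errE (c : {ffun 'I_m -> 'I_J}) i l :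
    (A *m ((sampling_matrix q c)^T *m sampling_matrix q c) *m C - A *m C) i l =
    m%:R^-1 * \sum_t g i l (c t).
  rewrite sumrB sumr_const card_ord mulrBr -(mulr_natl (mu i l)) mulKf //.
  by rewrite -sampled_productE // [LHS]mxE; congr (_ + _); rewrite mxE.
have entry i l : \sum_(c : {ffun 'I_m -> 'I_J}) (\prod_t q (c t)) *
    (A *m ((sampling_matrix q c)^T *m sampling_matrix q c) *m C - A *m C) i l ^+ 2
    <= m%:R^-1 * \sum_j A i j ^+ 2 * C j l ^+ 2 / q j.
  under eq_bigr do rewrite errE exprMn mulrCA.
  rewrite -mulr_sumr sum_iid_sqr // mulrA.
  rewrite (_ : m%:R^-1 ^+ 2 * _ = m%:R^-1); last by field.
  rewrite ler_wpM2l ?invr_ge0 // -subr_ge0.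
  (* The second moment exceeds the variance by the square of the mean [mu i l]. *)
  have -> : \sum_j A i j ^+ 2 * C j l ^+ 2 / q j - \sum_j q j * g i l j ^+ 2 =
      mu i l ^+ 2; last exact: sqr_ge0.
  have -> : \sum_j A i j ^+ 2 * C j l ^+ 2 / q j =
      \sum_j (q j * g i l j ^+ 2 + 2 * mu i l * (q j * g i l j) +
              mu i l ^+ 2 * q j).
    apply: eq_bigr => j _.
    have -> : A i j ^+ 2 * C j l ^+ 2 / q j = q j * y i l j ^+ 2.
      by rewrite [y i l j ^+ 2]expr2 mulrA qy /y; ring.
    by rewrite /g; ring.
  by rewrite !big_split /= -!mulr_sumr qg0 q1; ring.
have -> : \sum_(c : {ffun 'I_m -> 'I_J}) (\prod_t q (c t)) *
    sqfro (A *m ((sampling_matrix q c)^T *m sampling_matrix q c) *m C - A *m C) =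
    \sum_i \sum_l \sum_(c : {ffun 'I_m -> 'I_J}) (\prod_t q (c t)) *
    (A *m ((sampling_matrix q c)^T *m sampling_matrix q c) *m C - A *m C) i l ^+ 2.
  under eq_bigr do rewrite mulr_sumr.
  rewrite exchange_big; apply: eq_bigr => i _ /=.
  by under eq_bigr do rewrite mulr_sumr; rewrite exchange_big.
apply: (@le_trans _ _
    (\sum_i \sum_l m%:R^-1 * \sum_j A i j ^+ 2 * C j l ^+ 2 / q j)).
  by apply: ler_sum => i _; apply: ler_sum => l _.
rewrite [K / _]mulrC -mulrA; under eq_bigr do rewrite -mulr_sumr.
rewrite -mulr_sumr ler_wpM2l ?invr_ge0 // mulr_sumr; apply: ler_sum => i _.
rewrite exchange_big mulr_sumr; apply: ler_sum => j _ /=.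
rewrite -mulr_suml -mulr_sumr -mulrA mulrC ler_wpM2r ?sqr_ge0 //.
have [->|qj] := eqVneq (q j) 0; first by rewrite invr0 mulr0.
by rewrite ler_pdivrMr ?CK // lt_neqAle eq_sym qj q0.
Qed.

(** * Rank count and conclusion *)

(** The column count supplies the missing factor [k = n]; around the cycle each rank then occurs
    twice. *)
Lemma prod_rank_neq (R : comNzRingType) (N : nat) (rk : 'I_N -> nat) (n : 'I_N) :
  (\prod_(k | k != n) ((rk k)%:R * (rk (ordS k))%:R)) *
    (rk (ordS n) * rk n)%:R = \prod_(j < N) (rk j)%:R ^+ 2 :> R.
Proof.
transitivity (\prod_k ((rk k)%:R * (rk (ordS k))%:R) : R).
  by rewrite [RHS](bigD1 n) //= -natrM mulnC mulrC.
under [RHS]eq_bigr do rewrite expr2.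
rewrite !big_split /=; congr (_ * _).
by rewrite [RHS](reindex_inj (can_inj (@ordSK N))).
Qed.

Lemma sqfro_orthonormal (R : realType) (J r : nat) (Q : 'M[R]_(J, r)) :
  Q^T *m Q = 1%:M -> sqfro Q^T = r%:R.
Proof. by move=> QQ; rewrite sqfro_trace trmxK QQ mxtrace1. Qed.

Theorem theorem3p2 (R : realType) (N : nat) (dim rk : 'I_N -> nat)
    (X : tensor R dim) (G : tr_cores R dim rk) (n : 'I_N) (m : nat)
    (eps delta : R)
    (d : measure_display) (T : measurableType d) (P : probability T R)
    (trial : 'I_m -> T -> 'I_(num_cols dim n))
    (G_neq0 : forall k, exists u i v, G k u i v != 0)
    (trialP : iid_trials P (sampling_distribution G n) trial)
    (eps_gt0 : 0 < eps) (eps_lt1 : eps < 1)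
    (delta_gt0 : 0 < delta) (delta_lt1 : delta < 1)
    (m_large : m%:R > (\prod_(j < N) (rk j)%:R ^+ 2) *
       Num.max (16 / (3 * (Num.sqrt 2 - 1) ^+ 2) *
                  ln (4 * (rk n)%:R * (rk (ordS n))%:R / delta))
               (4 / (eps * delta))) :
  let Psi (w : T) :=
    sampling_matrix (sampling_distribution G n) (trial ^~ w) in
  let loss (H : 'M[R]_(dim n, rk (ordS n) * rk n)) :=
    frobenius_norm (unfolding X n - H *m (subchain_unfolding G n)^T) in
  let sketched_loss (w : T) (H : 'M[R]_(dim n, rk (ordS n) * rk n)) :=
    frobenius_norm (unfolding X n *m (Psi w)^T
                    - H *m (Psi w *m subchain_unfolding G n)^T) in
  exists2 Hmin, is_argmin loss Hmin &
    ((1 - delta)%:E <=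
       P [set w | forall Ht, is_argmin (sketched_loss w) Ht ->
                    (loss Ht <= (1 + eps) * loss Hmin)%R])%E.
Proof.
move=> Psi loss sketched_loss.
set Y := unfolding X n in loss sketched_loss *.
set B := subchain_unfolding G n in loss sketched_loss *.
pose q := sampling_distribution G n.
have [Hmin HminP] := argmin_frobenius_exists Y B.
exists Hmin; first exact: HminP.
have [Q QB] := orthonormal_col_basis_exists B; have [QQ _] := QB.
pose d' := (rk (ordS n) * rk n)%N.
pose K : R := \prod_(k | k != n) ((rk k)%:R * (rk (ordS k))%:R).
have rk0 k : (0 < rk k)%N.
  by have [u _] := G_neq0 k; exact: leq_ltn_trans (ltn_ord u).
have d1 : 1 <= d'%:R :> R by rewrite ler1n muln_gt0 !rk0.
have K0 : 0 < K by apply: prodr_gt0 => k _; rewrite mulr_gt0 // ltr0n.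
have ed0 : 0 < eps * delta by rewrite mulr_gt0.
(* This comes from the second entry of the maximum. *)
have m_gt : K * d'%:R * 4 < m%:R * (eps * delta).
  rewrite -ltr_pdivrMr // -(mulrA _ 4); apply: le_lt_trans m_large.
  rewrite -(prod_rank_neq _ rk n) -/K -/d' ler_wpM2l ?le_max ?lexx ?orbT //.
  by rewrite mulr_ge0 // ltW.
have m0 : (0 < m)%N.
  rewrite lt0n; apply/eqP => m0; move: m_gt; rewrite m0 mul0r; nra.
have [q0 q1] := iid_trials_distribution m0 trialP.
have QK j : \sum_l Q j l ^+ 2 <= K * q j.
  by rewrite -(leverage_scoreE j QB) leverage_score_le_sampling_distribution.
pose S (c : {ffun 'I_m -> 'I_(num_cols dim n)}) :=
  (sampling_matrix q c)^T *m sampling_matrix q c.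
pose Xp := Y - Y *m Q *m Q^T.
have XpQ : Xp *m Q = 0.
  by rewrite mulmxBl -(mulmxA (Y *m Q)) QQ mulmx1 subrr.
pose V c := (eps * sqfro Xp)^-1 * sqfro (Xp *m S c *m Q) +
  2 * sqfro (Q^T *m S c *m Q - 1%:M).
have V0 c : 0 <= V c.
  by rewrite addr_ge0 ?mulr_ge0 ?invr_ge0 ?mulr_ge0 ?sqfro_ge0 // ltW.
have EV : \sum_(c : {ffun 'I_m -> 'I_(num_cols dim n)})
    (\prod_i q (c i)) * V c <= delta.
  (* Both error terms are errors of sampled products, with exact values [Xp *m Q = 0] and
     [Q^T *m Q = 1%:M], so one variance bound serves for both. *)
  have E1 := expected_sampled_product_error Xp m0 (ltW K0) q0 q1 QK.
  have E2 := expected_sampled_product_error Q^T m0 (ltW K0) q0 q1 QK.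
  rewrite XpQ in E1; rewrite QQ (sqfro_orthonormal QQ) in E2.
  under eq_bigr do rewrite mulrDr mulrCA [X in _ + X]mulrCA.
  rewrite big_split -!mulr_sumr /=.
  under eq_bigr do rewrite -[Xp *m _ *m Q]subr0.
  apply: (@le_trans _ _ ((eps * sqfro Xp)^-1 * (K / m%:R * sqfro Xp) +
    2 * (K / m%:R * (\rank B)%:R))).
    by rewrite lerD // ler_wpM2l // invr_ge0 mulr_ge0 ?sqfro_ge0 // ltW.
  have rd : (\rank B)%:R <= d'%:R :> R by rewrite ler_nat rank_leq_col.
  have mR : 0 < m%:R :> R by rewrite ltr0n.
  apply: (@le_trans _ _ (K / m%:R / eps + 2 * (K / m%:R * d'%:R))).
    rewrite lerD //; last by rewrite ler_wpM2l // ler_wpM2l // divr_ge0 // ltW.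
    have [->|x0] := eqVneq (sqfro Xp) 0.
      by rewrite mulr0 invr0 mul0r !divr_ge0 // ltW.
    by rewrite le_eqVlt; apply/orP; left; apply/eqP; field; rewrite x0 !gt_eqF.
  have -> : K / m%:R / eps + 2 * (K / m%:R * d'%:R) =
    (K + 2 * eps * K * d'%:R) / (m%:R * eps) by field; rewrite !gt_eqF.
  (* With [1 <= d'] and [eps < 1] the numerator is at most three times [K * d'%:R], while [m_gt]
     leaves room for four. *)
  have Kd : K <= K * d'%:R by rewrite ler_peMr // ltW.
  have eKd : eps * (K * d'%:R) <= K * d'%:R.
    by rewrite ger_pMl ?(lt_le_trans K0) // ltW.
  rewrite ler_pdivrMr ?mulr_gt0 //; lra.
pose good (c : 'I_m -> 'I_(num_cols dim n)) := forall Ht : 'M[R]_(dim n, d'),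
  is_argmin (fun H => frobenius_norm (Y *m (sampling_matrix q c)^T
    - H *m (sampling_matrix q c *m B)^T)) Ht ->
  loss Ht <= (1 + eps) * loss Hmin.
(* Success depends on the outcome only through the chosen indices, so its probability is a finite
   sum. *)
have -> : [set w | forall Ht, is_argmin (sketched_loss w) Ht ->
    loss Ht <= (1 + eps) * loss Hmin] =
    [set w | `[< good [ffun i => trial i w] >]].
  apply/funext => w /=; apply/propext.
  have -> : [ffun i => trial i w] = trial ^~ w :> ('I_m -> _).
    by apply/funext => i; rewrite ffunE.
  by split=> [/asboolP|/asboolP].
rewrite (iid_trials_prob (fun c => `[< good c >]) trialP) lee_fin.
apply: (le_trans (markov_ffun q0 q1 V0 EV)).
rewrite big_mkcond [leRHS]big_mkcond; apply: ler_sum => c _.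
have p0 : 0 <= \prod_i q (c i) by apply: prodr_ge0.
case: ifPn => [V1|_]; last by case: ifP.
rewrite ifT //; apply/asboolP => Ht HtP.
have := sketched_least_squares eps_gt0 QB HtP V1; rewrite -/Xp => le1.
have [W _ HminE] := sqfro_residual Y Hmin QB.
have le2 : sqfro Xp <= sqfro (Y - Hmin *m B^T).
  by rewrite HminE lerDl sqfro_ge0.
have e1 : 0 <= 1 + eps by lra.
apply: (@le_trans _ _ ((1 + eps) * Num.sqrt (sqfro Xp))); last first.
  by rewrite ler_wpM2l // /loss frobenius_normE ler_sqrt // sqfro_ge0.
rewrite /loss frobenius_normE -[X in X * _](ger0_norm e1) -sqrtr_sqr.
rewrite -sqrtrM ?sqr_ge0 // ler_sqrt ?mulr_ge0 ?sqr_ge0 ?sqfro_ge0 //.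
(* The squared bound suffices because [1 + 2 * eps <= (1 + eps) ^+ 2]. *)
apply: le_trans le1 _; rewrite ler_wpM2r ?sqfro_ge0 //; nra.
Qed.
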